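(* Let $s\ge 2$ and $k\ge s+1$ be fixed integers, with $k=k'+k''s$ where $1\le k'\le s$ and $k''\ge 1$. Then the generating function $P_k(x;q)=\sum_{n\ge k}\bigl(\sum_{\pi\in\mathcal{P}_{n,k}}q^{\mu(\pi)}\bigr)x^n$ of the distribution on $\mathcal{P}_{n,k}$, $n\ge k$, for the number of occurrences of the string $a(a+s)$ is given by $$P_k(x;q)=\frac{x^k(1+(q-1)x)(1+(1-q)x)^{k-s+1}\left(1-((q-1)x)^{k''+1}\right)^{k'-1}}{\prod_{j=1}^s(1-jx)}\times\prod_{\ell=1}^{k''-1}\left(1-((q-1)x)^{\ell+1}\right)^{s-1}\left(1-((q-1)x)^{\ell+2}\right)\times\prod_{j=s+1}^kD_j(x;q),$$ where $D_j(x;q)$ for $j\ge s+1$ is given by $$D_j(x;q)=\frac{1}{1-(j-2+2q)x-(j+s-1+q)(1-q)x^2+\bigl(j'(1+(1-q)x)-s\bigr)x\,((q-1)x)^{j''+1}},$$ with $j=j'+j''s$ where $1\le j'\le s$ and $j''\ge 1$.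
   Context: $\mathcal{P}_{n,k}$ is the set of partitions of $[n]=\{1,\dots,n\}$ into $k$ nonempty blocks. A partition with blocks $T_1,\dots,T_k$, ordered so that $\min T_1<\min T_2<\cdots<\min T_k$, is identified with its sequential form (restricted growth function) $\pi=\pi_1\cdots\pi_n$, where $\pi_i$ is the index of the block containing $i$, i.e. $i\in T_{\pi_i}$. An occurrence of the string $a(a+s)$ in $\pi$ is an index $i\in\{1,\dots,n-1\}$ with $\pi_{i+1}-\pi_i=s$; $\mu(\pi)$ is the number of such indices. $q$ is an indeterminate; empty products equal $1$; the identity is one of formal power series in $x$. *)

(* Defs.v *)
From HB Require Import structures.
From mathcomp Require Import all_boot all_order all_algebra.
From mathcomp Require Import boolp.

Set Implicit Arguments.
Unset Strict Implicit.
Unset Printing Implicit Defensive.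

Import GRing.Theory.
Local Open Scope ring_scope.

Record fps (R : Type) : Type := Fps { coefs :> nat -> R }.

Lemma fpsP (R : Type) (f g : fps R) : coefs f =1 coefs g -> f = g.
Proof. by case: f g => [f] [g] /= /funext ->. Qed.

HB.instance Definition _ (R : Type) := gen_eqMixin (fps R).
HB.instance Definition _ (R : Type) := gen_choiceMixin (fps R).

Section FpsZmodule.
Variable R : zmodType.
Implicit Types f g h : fps R.

Definition fps_zero : fps R := Fps (fun=> 0).
Definition fps_opp f : fps R := Fps (fun n => - f n).
Definition fps_add f g : fps R := Fps (fun n => f n + g n).

Fact fps_addA : associative fps_add.
Proof. by move=> f g h; apply: fpsP => n /=; rewrite addrA. Qed.
Fact fps_addC : commutative fps_add.
Proof. by move=> f g; apply: fpsP => n /=; rewrite addrC. Qed.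
Fact fps_add0 : left_id fps_zero fps_add.
Proof. by move=> f; apply: fpsP => n /=; rewrite add0r. Qed.
Fact fps_addN : left_inverse fps_zero fps_opp fps_add.
Proof. by move=> f; apply: fpsP => n /=; rewrite addNr. Qed.

HB.instance Definition _ :=
  GRing.isZmodule.Build (fps R) fps_addA fps_addC fps_add0 fps_addN.

End FpsZmodule.

Section FpsRing.
Variable R : comNzRingType.
Implicit Types f g h : fps R.

Definition fpsC (c : R) : fps R := Fps (fun n => if n == 0%N then c else 0).
Definition fpsX : fps R := Fps (fun n => (n == 1%N)%:R).

Definition fps_mul f g : fps R :=
  Fps (fun n => \sum_(i < n.+1) f i * g (n - i)%N).

(* Multiplication only sees finitely many coefficients at a time, so that the
   ring axioms can be imported from truncations in [{poly R}]. *)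
Let tr n f : {poly R} := \poly_(i < n.+1) f i.

Let trE n f i : (i <= n)%N -> (tr n f)`_i = f i.
Proof. by move=> le_in; rewrite coef_poly ltnS le_in. Qed.

Let mul_tr n f g i : (i <= n)%N -> fps_mul f g i = (tr n f * tr n g)`_i.
Proof.
move=> le_in; rewrite coefM /=; apply: eq_bigr => j _.
have le_ji : (j <= i)%N by rewrite -ltnS.
by rewrite !trE // (leq_trans _ le_in) ?leq_subr.
Qed.

Fact fps_mulC : commutative fps_mul.
Proof. by move=> f g; apply: fpsP => n; rewrite !(@mul_tr n) // mulrC. Qed.

Fact fps_mulA : associative fps_mul.
Proof.
move=> f g h; apply: fpsP => n.
transitivity ((tr n f * (tr n g * tr n h))`_n).
  rewrite coefM /=; apply: eq_bigr => i _.
  have le_in : (i <= n)%N by rewrite -ltnS.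
  by rewrite trE // -(@mul_tr n) ?leq_subr.
rewrite mulrA coefM /=; apply: eq_bigr => i _.
have le_in : (i <= n)%N by rewrite -ltnS.
by rewrite trE ?leq_subr // -(@mul_tr n).
Qed.

Fact fps_mul1 : left_id (fpsC 1) fps_mul.
Proof.
move=> f; apply: fpsP => n /=.
by rewrite big_ord_recl mul1r subn0 big1 ?addr0 // => i _; rewrite mul0r.
Qed.

Fact fps_mulDl : left_distributive fps_mul +%R.
Proof.
move=> f g h; apply: fpsP => n /=; rewrite -big_split /=.
by apply: eq_bigr => i _; rewrite mulrDl.
Qed.

Fact fps_1neq0 : fpsC 1 != 0.
Proof.
by apply/eqP => /(congr1 (fun f : fps R => f 0%N)) /= /eqP; rewrite oner_eq0.
Qed.

HB.instance Definition _ := GRing.Zmodule_isComNzRing.Build (fps R)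
  fps_mulA fps_mulC fps_mul1 fps_mulDl fps_1neq0.

End FpsRing.

Section FpsUnitRing.
Variable R : comUnitRingType.
Implicit Types f g : fps R.

Fixpoint fps_inv_seq f n : seq R :=
  if n is m.+1 then
    let s := fps_inv_seq f m in
    rcons s (- (f 0%N)^-1 * \sum_(i < m.+1) f i.+1 * s`_(m - i))
  else [:: (f 0%N)^-1].

Definition fps_unit : pred (fps R) := fun f => f 0%N \is a GRing.unit.

Definition fps_inv f : fps R :=
  if fps_unit f then Fps (fun n => (fps_inv_seq f n)`_n) else f.

Let size_inv_seq f n : size (fps_inv_seq f n) = n.+1.
Proof. by elim: n => //= n IHn; rewrite size_rcons IHn. Qed.

Let nth_inv_seq f n i :
  (i <= n)%N -> (fps_inv_seq f n)`_i = (fps_inv_seq f i)`_i.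
Proof.
elim: n => [|n IHn]; first by rewrite leqn0 => /eqP ->.
rewrite leq_eqVlt => /predU1P[-> //|]; rewrite ltnS => le_in.
by rewrite /= nth_rcons size_inv_seq ltnS le_in IHn.
Qed.

Fact fps_mulVr : {in fps_unit, left_inverse 1 fps_inv *%R}.
Proof.
move=> f Uf; have Uf0 : f 0%N \is a GRing.unit := Uf.
have -> : fps_inv f = Fps (fun n => (fps_inv_seq f n)`_n).
  by rewrite /fps_inv ifT.
rewrite mulrC; apply: fpsP => -[|n] /=.
  by rewrite big_ord1 /= mulrV.
rewrite big_ord_recl subn0 /= nth_rcons size_inv_seq ltnn eqxx.
rewrite mulrA mulrN mulrV // mulN1r.
apply/eqP; rewrite addrC subr_eq0; apply/eqP/eq_bigr => i _.
by rewrite /= /bump /= add1n subSS [in RHS]nth_inv_seq ?leq_subr.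
Qed.

Fact fps_unitPl f g : g * f = 1 -> fps_unit f.
Proof.
move/(congr1 (fun h : fps R => h 0%N)); rewrite /= big_ord1 /= => gf1.
by apply/unitrPr; exists (g 0%N); rewrite mulrC.
Qed.

Fact fps_inv_out : {in [predC fps_unit], fps_inv =1 id}.
Proof. by move=> f /negPf Uf; rewrite /fps_inv ifF. Qed.

HB.instance Definition _ := GRing.ComNzRing_hasMulInverse.Build (fps R)
  fps_mulVr fps_unitPl fps_inv_out.

Lemma unitfpsE f : (f \is a GRing.unit) = (f 0%N \is a GRing.unit).
Proof. by []. Qed.

End FpsUnitRing.

(* Here [n] = {1, ..., n} is represented by 'I_n = {0, ..., n - 1}. *)

Definition is_kpartition (n k : nat) (P : {set {set 'I_n}}) : bool :=
  partition P [set: 'I_n] && (#|P| == k).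

(* The cap n is never attained when B is nonempty. *)
Definition block_min (n : nat) (B : {set 'I_n}) : nat :=
  (\big[minn/n]_(i in B) i)%N.

Definition ordered_blocks (n : nat) (P : {set {set 'I_n}}) : seq {set 'I_n} :=
  sort (fun A B => block_min A <= block_min B)%N (enum P).

Definition seqform (n : nat) (P : {set {set 'I_n}}) : seq nat :=
  [seq (index (pblock P i) (ordered_blocks P)).+1 | i <- enum 'I_n].

Definition occ (s : nat) (w : seq nat) : nat :=
  count (fun i => nth 0 w i.+1 == nth 0 w i + s)%N (iota 0 (size w).-1).

Definition q : fps {poly int} := fpsC 'X.
Definition x : fps {poly int} := fpsX {poly int}.

Definition distr (s n k : nat) : {poly int} :=
  \sum_(P : {set {set 'I_n}} | is_kpartition k P) 'X^(occ s (seqform P)).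

Definition Pgf (s k : nat) : fps {poly int} :=
  Fps (fun n => if (k <= n)%N then distr s n k else 0).

(* The decomposition j = j' + j'' s with 1 <= j' <= s. *)
Definition res1 (s j : nat) : nat := (j.-1 %% s).+1.
Definition quo1 (s j : nat) : nat := (j.-1 %/ s)%N.

Lemma res1_quo1P (s j j' j'' : nat) : (1 <= j' <= s)%N ->
  j = (j' + j'' * s)%N <-> [/\ (0 < j)%N, j' = res1 s j & j'' = quo1 s j].
Proof.
case: j' => // j' /= lt_js; split.
  move=> ->; rewrite /res1 /quo1 addSn /= addnC modnMDl modn_small //.
  by rewrite divnMDl ?(leq_trans _ lt_js) // divn_small ?addn0.
case: j => [[] //|j [_ -> ->]].
by rewrite /res1 /quo1 /= addSn addnC -divn_eq.
Qed.

(* The denominator has constant coefficient 1, so the inverse is a genuine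
   inverse of power series. *)
Definition D (s j : nat) : fps {poly int} :=
  let j' := res1 s j in
  let j'' := quo1 s j in
  1 / (1 - (j%:R - 2 + 2 * q) * x
         - (j%:R + s%:R - 1 + q) * (1 - q) * x ^+ 2
         + (j'%:R * (1 + (1 - q) * x) - s%:R) * x
           * ((q - 1) * x) ^+ j''.+1).

(* Main.v *)
Require Import Defs.
From mathcomp Require Import all_boot all_order all_algebra ring zify.

(** Write z = (q - 1) x and S_m = 1 + z + ... + z^m (the series [geomz m]).

    A partition with k blocks is the same thing as its sequential form, a word
    whose distinct letters, listed by first occurrence, are 1, ..., k
    ([seqform_inj], [seqform_surj], [distrE]).  Building such words one letter
    at a time on the right, let P_k be the generating function of the words
    with k distinct letters and F_(k,a) the part coming from words that end in
    a.  Appending a to a word multiplies its weight by x, and by a further q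
    exactly when the word ends in a - s; since q = 1 + (q - 1), this gives for
    a < k

      F_(k,a) = x P_k + z F_(k,a-s),   hence   F_(k,a) = x P_k S_((a-1)/s),

    with integer division in the index ([end_gf_geom]).  The letter a = k can
    also be appended to a word with only k - 1 distinct letters, which adds
    x P_(k-1) S_((k-1)/s); the hypothesis s >= 2 enters here, because it makes
    the relevant previous letter k - s smaller than k - 1, so that the formula
    for non-maximal letters applies to it.  Summing over a,

      P_k (1 - x (S_(0/s) + ... + S_((k-1)/s))) = x P_(k-1) S_((k-1)/s)

    ([rgf_gf_rec]), so that P_k is an explicit product ([rgf_gf_prod]).

    The closed form follows from (1 - z) S_m = 1 - z^(m+1).  Multiplied by
    (1 - z)^2, the factor 1 - x (S_(0/s) + ... + S_((j-1)/s)) becomes the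
    denominator of D_j ([rgf_den_D_den]), while for j <= s it is just 1 - j x.
    This leaves (1 - z)^(k-s) times the product of 1 - z^(i/s + 1) over
    s <= i < k ([rgf_gf_D]).  Grouping the i with equal i/s and moving one
    factor of each group by one place ([prod_shift]) produces the exponents of
    the theorem. *)

Set Implicit Arguments.
Unset Strict Implicit.
Unset Printing Implicit Defensive.

Import GRing.Theory.
Local Open Scope ring_scope.

(** * Sequential forms as standardized words *)

(** The distinct entries of a sequence in order of first occurrence; [undup]
    alone keeps the last occurrences. *)
Definition firsts (T : eqType) (t : seq T) : seq T := rev (undup (rev t)).

Lemma firsts_rcons (T : eqType) (t : seq T) (a : T) :
  firsts (rcons t a) = if a \in t then firsts t else rcons (firsts t) a.
Proof. by rewrite /firsts rev_rcons /= mem_rev; case: ifP; rewrite ?rev_cons. Qed.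

Lemma mem_firsts (T : eqType) (t : seq T) : firsts t =i t.
Proof. by move=> a; rewrite mem_rev mem_undup mem_rev. Qed.

Lemma firsts_uniq (T : eqType) (t : seq T) : uniq (firsts t).
Proof. by rewrite rev_uniq undup_uniq. Qed.

Lemma size_firsts (T : eqType) (t : seq T) : (size (firsts t) <= size t)%N.
Proof. by rewrite size_rev -(size_rev t) size_undup. Qed.

Lemma firsts_map (T U : eqType) (f : T -> U) (t : seq T) :
  {in t &, injective f} -> firsts (map f t) = map f (firsts t).
Proof.
elim/last_ind: t => [//|t a IH] f_inj.
have f_inj_t : {in t &, injective f}.
  by move=> b c bt ct; apply: f_inj; rewrite mem_rcons inE ?bt ?ct orbT.
have -> : map f (rcons t a) = rcons (map f t) (f a) by rewrite map_rcons.
rewrite !firsts_rcons IH //.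
have -> : (f a \in map f t) = (a \in t).
  apply/mapP/idP => [[b bt fab]|at_]; last by exists a.
  by rewrite (f_inj a b) // mem_rcons inE ?eqxx // bt orbT.
by case: ifP => // _; rewrite map_rcons.
Qed.

Lemma firsts_sorted (T : eqType) (t : seq T) :
  sorted (fun a b => index a t <= index b t)%N (firsts t).
Proof.
apply: pairwise_sorted; elim/last_ind: t => [//|t a IH].
have IH' : pairwise (fun b c => index b (rcons t a) <= index c (rcons t a))%N
                    (firsts t).
  rewrite -(eq_in_pairwise (P := mem t) (r := fun b c => index b t <= index c t)%N) //.
  - by move=> b c /= bt ct; rewrite -cats1 !index_cat bt ct.
  - by apply/allP => b; rewrite mem_firsts.
rewrite firsts_rcons; case: ifP => // a_t.
rewrite pairwise_rcons IH' andbT; apply/allP => b; rewrite mem_firsts => bt.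
by rewrite -cats1 !index_cat bt a_t /= eqxx addn0 index_size.
Qed.

(** Relabels the entries by 1, 2, 3, ... in order of first occurrence.  The
    sequential form of P standardizes the word whose i-th entry is the block
    of i, so that facts on sequential forms become facts on words. *)
Definition standardize (T : eqType) (t : seq T) : seq nat :=
  [seq (index a (firsts t)).+1 | a <- t].

Lemma firsts_standardize (T : eqType) (t : seq T) :
  firsts (standardize t) = iota 1 (size (firsts t)).
Proof.
rewrite /standardize firsts_map; last first.
  by move=> a b at_ bt [] /(index_inj a) -> //; rewrite mem_firsts.
case E: (firsts t) => [//|a0 l]; rewrite -E.
apply: (@eq_from_nth _ 0%N); rewrite size_map ?size_iota // => i lt_i.
by rewrite (nth_map a0) // nth_iota // index_uniq ?firsts_uniq.
Qed.

Lemma standardize_map (T U : eqType) (f : T -> U) (t : seq T) :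
  {in t &, injective f} -> standardize (map f t) = standardize t.
Proof.
move=> f_inj; rewrite /standardize firsts_map // -map_comp; apply/eq_in_map => a at_ /=.
congr _.+1; have: all (mem t) (firsts t) by apply/allP => b; rewrite mem_firsts.
elim: (firsts t) => [//|b l IH] /= /andP[bt /IH ->].
by rewrite (inj_in_eq f_inj).
Qed.

Lemma standardize_id (k : nat) (w : seq nat) :
  firsts w = iota 1 k -> standardize w = w.
Proof.
move=> wk; rewrite /standardize wk -[RHS]map_id; apply/eq_in_map => a.
rewrite -mem_firsts wk mem_iota add1n ltnS; case: a => //= a lt_ak.
rewrite -[X in index X _](nth_iota 0 1 lt_ak) index_uniq ?iota_uniq //.
by rewrite size_iota.
Qed.

(** This turns the order on blocks by minima into the order of first occurrence
    in the word of blocks. *)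
Lemma block_min_pblock (n : nat) (P : {set {set 'I_n}}) (B : {set 'I_n}) :
  partition P setT -> B \in P ->
  block_min B = index B [seq pblock P i | i <- enum 'I_n].
Proof.
case/and3P=> /eqP covP tiP P0 BP; set t := map _ _.
have nth_t (i : 'I_n) : nth B t i = pblock P i.
  by rewrite (nth_map i) ?nth_ord_enum ?size_enum_ord.
have Bt : B \in t.
  have /set0Pn[i iB] : B != set0 by apply: contraNneq P0 => <-.
  by apply/mapP; exists i; rewrite ?mem_enum // (def_pblock tiP BP iB).
have lt_n : (index B t < n)%N.
  by rewrite -[X in (_ < X)%N](size_enum_ord n) -(size_map (pblock P)) index_mem.
have iB : Ordinal lt_n \in B.
  have {2}<- : pblock P (Ordinal lt_n) = B by rewrite -nth_t nth_index.
  by rewrite mem_pblock covP inE.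
apply/eqP; rewrite eqn_leq /block_min; apply/andP; split.
  have: Ordinal lt_n \in index_enum 'I_n by rewrite mem_index_enum.
  rewrite -[X in (_ <= X)%N]/(nat_of_ord (Ordinal lt_n)).
  elim: (index_enum _) => [//|j r IH]; rewrite inE big_cons.
  by case/predU1P => [<-|/IH le_r]; [rewrite iB geq_minl|case: ifP => // _;
    rewrite (leq_trans (geq_minr _ _))].
apply: (big_ind (leq (index B t))) => [||i iB']; first exact: ltnW.
  by move=> a b la lb; rewrite leq_min la.
rewrite leqNgt; apply/negP => /(before_find B) /=.
by rewrite nth_t (def_pblock tiP BP iB') eqxx.
Qed.

(** Both sides list the blocks by increasing minimum, and distinct blocks have
    distinct minima, so the sorted list is unique. *)
Lemma ordered_blocksE (n : nat) (P : {set {set 'I_n}}) :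
  partition P setT ->
  ordered_blocks P = firsts [seq pblock P i | i <- enum 'I_n].
Proof.
move=> partP; have [/eqP covP tiP P0] := and3P partP.
set t := map _ _.
have mem_t B : (B \in t) = (B \in P).
  apply/mapP/idP => [[i _ ->]|BP]; first by rewrite pblock_mem ?covP.
  have /set0Pn[i iB] : B != set0 by apply: contraNneq P0 => <-.
  by exists i; rewrite ?mem_enum // (def_pblock tiP BP iB).
set le_min := fun A B : {set 'I_n} => (block_min A <= block_min B)%N.
have le_minE : {in P &, le_min =2 fun A B => index A t <= index B t}%N.
  by move=> A B AP BP; rewrite /le_min !(block_min_pblock partP).
have perm_t : perm_eq (enum P) (firsts t).
  rewrite uniq_perm ?enum_uniq ?firsts_uniq // => B.
  by rewrite mem_enum mem_firsts mem_t.
have -> : ordered_blocks P = sort le_min (firsts t).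
  apply/perm_sort_inP => // [A B _ _|B A C _ _ _|A B].
  - exact: leq_total.
  - exact: leq_trans.
  - rewrite !mem_enum => AP BP; rewrite !(block_min_pblock partP) // -eqn_leq.
    by move/eqP/(index_inj A) -> => //; rewrite mem_t.
apply: sorted_sort => [B A C|]; first exact: leq_trans.
rewrite (eq_in_sorted le_minE); first exact: firsts_sorted.
by apply/allP => B; rewrite mem_firsts mem_t.
Qed.

Lemma seqformE (n : nat) (P : {set {set 'I_n}}) :
  partition P setT -> seqform P = standardize [seq pblock P i | i <- enum 'I_n].
Proof. by move=> partP; rewrite /seqform ordered_blocksE // /standardize -[RHS]map_comp. Qed.

Lemma firsts_seqform (n : nat) (P : {set {set 'I_n}}) :
  partition P setT -> firsts (seqform P) = iota 1 #|P|.
Proof.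
move=> partP; rewrite seqformE // firsts_standardize -ordered_blocksE //.
by rewrite size_sort -cardE.
Qed.

Lemma size_seqform (n : nat) (P : {set {set 'I_n}}) : size (seqform P) = n.
Proof. by rewrite size_map size_enum_ord. Qed.

Lemma nth_seqform (n : nat) (P : {set {set 'I_n}}) (i : 'I_n) :
  nth 0%N (seqform P) i = (index (pblock P i) (ordered_blocks P)).+1.
Proof. by rewrite (nth_map i) ?size_enum_ord ?nth_ord_enum. Qed.

(** Two points lie in the same block iff their letters agree, so the word
    determines the partition as the fibres of its letters. *)
Lemma seqform_inj (n : nat) :
  {in [pred P : {set {set 'I_n}} | partition P setT] &, injective (@seqform n)}.
Proof.
move=> P Q /= partP partQ.
rewrite -{2}(preim_partition_pblock partP) -{2}(preim_partition_pblock partQ).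
have blockP (O : {set {set 'I_n}}) (i j : 'I_n) : partition O setT ->
    (pblock O i == pblock O j) = (nth 0%N (seqform O) i == nth 0%N (seqform O) j).
  move=> partO; rewrite !nth_seqform eqSS; apply/eqP/eqP => [->//|].
  have [/eqP covO _ _] := and3P partO.
  by apply: (index_inj (pblock O i));
    rewrite mem_sort mem_enum pblock_mem ?covO.
move=> eqPQ; apply: eq_imset => i; apply/setP => j; rewrite !inE /=.
by rewrite !blockP // eqPQ.
Qed.

(** The partition into fibres of w works: its word of blocks is an injective
    relabelling of w, and w is its own standardization. *)
Lemma seqform_surj (n k : nat) (w : seq nat) :
  size w = n -> firsts w = iota 1 k ->
  exists2 P : {set {set 'I_n}}, is_kpartition k P & seqform P = w.
Proof.
move=> sz_w wk; pose f (i : 'I_n) := nth 0%N w i.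
pose P := preim_partition f setT.
have partP : partition P setT by apply: preim_partitionP.
have Pw : seqform P = w.
  pose g (a : nat) := [set j : 'I_n | f j == a].
  have -> : seqform P = standardize (map g w).
    rewrite seqformE //; congr standardize.
    have -> : w = [seq f i | i <- enum 'I_n].
      apply: (@eq_from_nth _ 0%N) => [|i]; first by rewrite size_map size_enum_ord.
      rewrite sz_w => lt_in; rewrite (nth_map (Ordinal lt_in)) ?size_enum_ord //.
      by rewrite -[i in RHS]/(val (Ordinal lt_in)) nth_ord_enum.
    rewrite -map_comp; apply: eq_map => i /=; apply/setP => j.
    rewrite pblock_equivalence_partition ?inE 1?eq_sym //.
    by move=> a b c _ _ _; split=> // /eqP->.
  rewrite standardize_map ?(standardize_id wk) // => a b /(nthP 0%N)[i lt_iw <-] _ /setP.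
  rewrite sz_w in lt_iw.
  by move/(_ (Ordinal lt_iw)); rewrite !inE /f /= eqxx => /esym/eqP.
exists P => //; rewrite /is_kpartition partP /=.
have := firsts_seqform partP; rewrite Pw wk => /(congr1 size).
by rewrite !size_iota => ->.
Qed.

(** Enumerates the restricted growth functions of length n with maximum k
    according to their last letter, which is either an old letter or a new
    maximum. *)
Fixpoint rgfs (n k : nat) : seq (seq nat) :=
  match n, k with
  | 0, 0 => [:: [::]]
  | 0, _.+1 => [::]
  | _.+1, 0 => [::]
  | m.+1, j.+1 => [seq rcons w a | w <- rgfs m k, a <- iota 1 k]
                  ++ [seq rcons w k | w <- rgfs m j]
  end.

Lemma rgfsSS (n k : nat) :
  rgfs n.+1 k.+1 = [seq rcons w a | w <- rgfs n k.+1, a <- iota 1 k.+1]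
                   ++ [seq rcons w k.+1 | w <- rgfs n k].
Proof. by []. Qed.

Lemma mem_rgfs (n k : nat) (w : seq nat) :
  (w \in rgfs n k) = (size w == n) && (firsts w == iota 1 k).
Proof.
elim: n k w => [|n IH] k w.
  by case: k w => [|k] [|a w]; rewrite ?inE.
case/lastP: w => [|w a].
  case: k => [//|k]; rewrite rgfsSS mem_cat; apply/negP => /orP[].
    by case/allpairsP => -[[|c u] b] [_ _].
  by case/mapP => -[].
rewrite size_rcons eqSS firsts_rcons; case: k => [|k].
  rewrite /= in_nil; case: ifP => [a_w|_]; last first.
    by case: (firsts w) => [|? ?]; rewrite andbF.
  case: eqP => //= _; apply/esym/eqP => w0.
  by rewrite -mem_firsts w0 in a_w.
rewrite rgfsSS mem_cat.
have -> : (rcons w a \in [seq rcons u b | u <- rgfs n k.+1, b <- iota 1 k.+1])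
   = (w \in rgfs n k.+1) && (a \in iota 1 k.+1).
  apply/allpairsP/andP => [[[u b] /= [uR bk /rcons_inj[-> ->]]]|[wR ak]] //.
  by exists (w, a).
have -> : (rcons w a \in [seq rcons u k.+1 | u <- rgfs n k])
   = (w \in rgfs n k) && (a == k.+1).
  apply/mapP/andP => [[u uR /rcons_inj[-> ->]]|[wR /eqP ->]] //.
  by exists w.
rewrite !IH; case: (size w == n) => //; rewrite !andTb; case: ifP => a_w.
  have -> : (firsts w == iota 1 k) && (a == k.+1) = false.
    apply/negP => /andP[/eqP wk /eqP ak].
    by move: a_w; rewrite -mem_firsts wk mem_iota ak; lia.
  rewrite orbF andb_idr // => /eqP wk.
  by move: a_w; rewrite -mem_firsts wk.
have -> : (firsts w == iota 1 k.+1) && (a \in iota 1 k.+1) = false.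
  by apply/negP => /andP[/eqP wk]; rewrite -wk mem_firsts a_w.
have -> : iota 1 k.+1 = rcons (iota 1 k) k.+1.
  by rewrite -cats1 -(iotaD 1 k 1) addn1.
by rewrite eqseq_rcons.
Qed.

Lemma rgfs_uniq (n k : nat) : uniq (rgfs n k).
Proof.
elim: n k => [|n IH] [|k] //; rewrite rgfsSS cat_uniq.
rewrite allpairs_uniq ?iota_uniq //; last by move=> [u b] [v c] _ _ /rcons_inj[-> ->].
rewrite map_inj_uniq ?IH ?andbT => [|u v /rcons_inj[]//].
apply/hasPn => _ /mapP[u uR ->]; apply/negP => /allpairsP[[v b] /= [vR _ /rcons_inj[uv _]]].
move: uR vR; rewrite -uv !mem_rgfs => /andP[_ /eqP->] /andP[_ /eqP/(congr1 size)].
by rewrite !size_iota; lia.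
Qed.

(** From here on the sum over set partitions is a sum over words. *)
Lemma distrE (s n k : nat) : distr s n k = \sum_(w <- rgfs n k) 'X^(occ s w).
Proof.
pose L := enum (@is_kpartition n k).
have LP P : (P \in L) = is_kpartition k P by rewrite mem_enum.
have -> : distr s n k = \sum_(w <- map (@seqform n) L) 'X^(occ s w).
  by rewrite big_map big_enum.
apply: perm_big; apply: uniq_perm; rewrite ?rgfs_uniq //.
  rewrite map_inj_in_uniq ?enum_uniq // => P Q.
  by rewrite !LP => /andP[partP _] /andP[partQ _]; apply: seqform_inj.
move=> w; rewrite mem_rgfs; apply/mapP/andP => [[P]|[/eqP sz_w /eqP wk]].
  rewrite LP => /andP[partP /eqP <-] ->.
  by rewrite size_seqform firsts_seqform.
by have [P Pk Pw] := seqform_surj sz_w wk; exists P; rewrite ?LP.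
Qed.

(** * Generating functions by last letter *)

Arguments rgfs : simpl never.

Lemma coef_fpsD (R : comNzRingType) (f g : fps R) n : (f + g) n = f n + g n.
Proof. by []. Qed.

Lemma coef_fpsB (R : comNzRingType) (f g : fps R) n : (f - g) n = f n - g n.
Proof. by []. Qed.

Lemma coef_fpsCM (R : comNzRingType) (c : R) (f : fps R) n :
  (fpsC c * f) n = c * f n.
Proof.
rewrite -[LHS]/(\sum_(i < n.+1) fpsC c i * f (n - i)%N).
by rewrite big_ord_recl subn0 big1 ?addr0 // => i _; rewrite mul0r.
Qed.

Lemma coef_fpsXM (R : comNzRingType) (f : fps R) n :
  (fpsX R * f) n = if n is m.+1 then f m else 0.
Proof.
rewrite -[LHS]/(\sum_(i < n.+1) fpsX R i * f (n - i)%N).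
rewrite big_ord_recl mul0r add0r; case: n => [|n]; first by rewrite big_ord0.
by rewrite big_ord_recl mul1r subn1 big1 ?addr0 // => i _; rewrite mul0r.
Qed.

Lemma coef_fps_sum (R : comNzRingType) (I : Type) (r : seq I) (P : pred I)
    (F : I -> fps R) n :
  (\sum_(i <- r | P i) F i) n = \sum_(i <- r | P i) F i n.
Proof. exact: (big_morph (fun f : fps R => f n)). Qed.

Lemma occ_rcons (s : nat) (w : seq nat) (a : nat) : w != [::] ->
  occ s (rcons w a) = (occ s w + (a == last 0 w + s))%N.
Proof.
case/lastP: w => [//|w b] _; rewrite last_rcons /occ !size_rcons [_.-1]/= [in RHS]/=.
have -> : iota 0 (size w).+1 = rcons (iota 0 (size w)) (size w).
  by rewrite -cats1 -(iotaD 0 _ 1) addn1.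
rewrite -[rcons (iota _ _) _]cats1 count_cat; congr addn.
  apply: eq_in_count => i; rewrite mem_iota add0n /= => lt_iw.
  by rewrite !(nth_rcons 0%N (rcons w b) a) size_rcons !ltnS lt_iw (ltnW lt_iw).
rewrite /= addn0 !(nth_rcons 0%N (rcons w b) a) size_rcons ltnn eqxx ltnSn.
by rewrite nth_rcons ltnn eqxx.
Qed.

Lemma rgf_gt0 (n k : nat) (w : seq nat) : w \in rgfs n k -> all (leq 1) w.
Proof.
rewrite mem_rgfs => /andP[_ /eqP wk]; apply/allP => a.
by rewrite -mem_firsts wk mem_iota => /andP[].
Qed.

(** Letters are positive and the default [last 0 w] of an empty word is 0, so
    comparing with a - s under the guard s < a treats all words alike. *)
Lemma occ_rcons_rgf (s n k : nat) (w : seq nat) (a : nat) :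
  w \in rgfs n k ->
  occ s (rcons w a) = (occ s w + ((s < a) && (last 0 w == a - s)))%N.
Proof.
move=> /rgf_gt0; case/lastP: w => [_|w b].
  by rewrite /occ /=; case: ltnP => //=; case: eqP => //; lia.
rewrite all_rcons => /andP[b_gt0 _]; rewrite occ_rcons; last by case: w.
rewrite last_rcons; congr (_ + nat_of_bool _)%N; apply/eqP/andP => [->|[]].
  by split; first lia; apply/eqP; lia.
by move=> lt_sa /eqP ->; lia.
Qed.

Definition rgf_gf (s k : nat) : fps {poly int} :=
  Fps (fun n => \sum_(w <- rgfs n k) 'X^(occ s w)).

(** For a > 0 the empty word, whose last letter reads as 0, is left out. *)
Definition end_gf (s k a : nat) : fps {poly int} :=
  Fps (fun n => \sum_(w <- rgfs n k | last 0%N w == a) 'X^(occ s w)).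

Lemma Pgf_rgf (s k : nat) : Pgf s k = rgf_gf s k.
Proof.
apply: fpsP => n /=; case: leqP => [_|lt_nk]; first exact: distrE.
case E: (rgfs n k) => [|w l]; first by rewrite big_nil.
have: w \in rgfs n k by rewrite E mem_head.
rewrite mem_rgfs => /andP[/eqP szw /eqP wk].
by have := size_firsts w; rewrite wk size_iota szw leqNgt lt_nk.
Qed.

(** Weighs a word w by its occurrences after a is appended, see
    [coef_ext_gf]: every word counts once, and those ending in a - s get the
    correction q - 1. *)
Definition ext_gf (s k a : nat) : fps {poly int} :=
  rgf_gf s k + (q - 1) * (if (s < a)%N then end_gf s k (a - s) else 0).

Lemma coef_ext_gf (s k a n : nat) :
  ext_gf s k a n = \sum_(w <- rgfs n k) 'X^(occ s (rcons w a)).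
Proof.
rewrite /ext_gf coef_fpsD mulrBl mul1r coef_fpsB coef_fpsCM.
have -> : coefs (if (s < a)%N then end_gf s k (a - s) else 0) n =
    \sum_(w <- rgfs n k | (s < a)%N && (last 0%N w == a - s)%N) 'X^(occ s w).
  by case: ifP => //= _; rewrite big_pred0.
rewrite -[X in _ - X]mul1r -mulrBl /= mulr_sumr [X in _ + X]big_mkcond -big_split /=.
apply: eq_big_seq => w /occ_rcons_rgf ->; case: andP => _; last by rewrite addn0 addr0.
by rewrite addn1 exprS; ring.
Qed.

Lemma coef_end_gfS (s n k a : nat) : (0 < a <= k.+1)%N ->
  end_gf s k.+1 a n.+1 = \sum_(w <- rgfs n k.+1) 'X^(occ s (rcons w a))
     + (if a == k.+1 then \sum_(w <- rgfs n k) 'X^(occ s (rcons w a)) else 0)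
  :> {poly int}.
Proof.
move=> a_k.
rewrite -[LHS]/(\sum_(w <- rgfs n.+1 k.+1 | last 0%N w == a) 'X^(occ s w)).
rewrite rgfsSS big_cat; congr (_ + _).
  rewrite big_mkcond big_allpairs_dep /=; apply: eq_bigr => w _.
  under eq_bigr => b _ do rewrite last_rcons.
  rewrite -big_mkcond /= -big_filter (_ : [seq _ <- _ | _] = [:: a]) ?big_seq1 //.
  by rewrite (filter_pred1_uniq (iota_uniq 1 k.+1)) // mem_iota; lia.
rewrite big_map; case: eqP => [->|ne_ak]; first by apply: eq_bigl => w; rewrite last_rcons eqxx.
by rewrite big_pred0 // => w; rewrite last_rcons; apply/eqP => /esym.
Qed.

Lemma end_gf_rec (s k a : nat) : (0 < a <= k.+1)%N ->
  end_gf s k.+1 a =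
    x * (ext_gf s k.+1 a + (if a == k.+1 then ext_gf s k a else 0)).
Proof.
move=> a_k; apply: fpsP => -[|n]; rewrite coef_fpsXM; first by rewrite /= big_nil.
rewrite coef_end_gfS // coef_fpsD coef_ext_gf; congr (_ + _).
by case: ifP => _ //; rewrite coef_ext_gf.
Qed.

Lemma rgf_gf_end (s k : nat) :
  rgf_gf s k.+1 = \sum_(i < k.+1) end_gf s k.+1 i.+1.
Proof.
apply: fpsP => -[|n]; rewrite coef_fps_sum.
  by rewrite /= big_nil big1 // => i _; rewrite big_nil.
rewrite /= -(big_mkord xpredT (fun i =>
  \sum_(w <- rgfs n.+1 k.+1 | last 0%N w == i.+1) 'X^(occ s w))).
rewrite (exchange_big_dep xpredT) //=; apply: eq_big_seq => w wR.
have : last 0%N w \in iota 1 k.+1.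
  move: wR; rewrite mem_rgfs; case/lastP: w => [//|w b]; rewrite last_rcons.
  by case/andP=> _ /eqP <-; rewrite mem_firsts mem_rcons mem_head.
rewrite mem_iota; case: (last _ _) => // b lt_b.
rewrite -big_filter (_ : [seq _ <- _ | _] = [:: b]) ?big_seq1 //.
rewrite (eq_filter (a2 := pred1 b)); last by move=> i /=; rewrite eqSS eq_sym.
by rewrite filter_pred1_uniq ?iota_uniq // mem_index_iota; lia.
Qed.

(** The weight of one step from a to a + s, with q - 1 in place of q as in an
    inclusion-exclusion over marked occurrences. *)
Definition z : fps {poly int} := (q - 1) * x.
Definition geomz (m : nat) : fps {poly int} := \sum_(i < m.+1) z ^+ i.

Lemma geomz0 : geomz 0 = 1.
Proof. by rewrite /geomz big_ord1 expr0. Qed.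

Lemma geomzS (m : nat) : geomz m.+1 = 1 + z * geomz m.
Proof.
rewrite /geomz big_ord_recl expr0 mulr_sumr; congr (_ + _).
by apply: eq_bigr => i _; rewrite -exprS.
Qed.

Lemma mul_subz_geomz (m : nat) : (1 - z) * geomz m = 1 - z ^+ m.+1.
Proof.
rewrite -[in RHS](expr1n _ m.+1) subrXX.
by under [in RHS]eq_bigr do rewrite expr1n mul1r.
Qed.

(** Subtracting s from the letter i.+1 lowers i/s by one, which matches the
    recurrence S_(m+1) = 1 + z S_m; the letters up to s have no predecessor and
    give S_0 = 1.  The premise isolates what is needed on smaller letters, so
    that the lemma serves both for old letters and for a new maximum. *)
Lemma ext_gf_geom (s k i : nat) : (0 < s)%N ->
  ((s <= i)%N -> end_gf s k (i - s).+1 = x * rgf_gf s k * geomz ((i - s) %/ s)) ->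
  ext_gf s k i.+1 = rgf_gf s k * geomz (i %/ s).
Proof.
move=> s_gt0 IH; rewrite /ext_gf ltnS; case: leqP => [le_si|lt_is].
  rewrite subSn // IH // -[in RHS](subnK le_si) divnDr ?dvdnn // divnn s_gt0 addn1.
  by rewrite geomzS /z; ring.
by rewrite mulr0 addr0 divn_small // geomz0 mulr1.
Qed.

(** An old letter that is not the maximum: induction along the chain
    i.+1, i.+1 - s, i.+1 - 2s, ..., all of whose members are below the maximum. *)
Lemma end_gf_geom (s k i : nat) : (0 < s)%N -> (i < k)%N ->
  end_gf s k.+1 i.+1 = x * rgf_gf s k.+1 * geomz (i %/ s).
Proof.
move=> s_gt0; elim/ltn_ind: i => i IH lt_ik.
rewrite end_gf_rec; last by lia.
rewrite eqSS (ltn_eqF lt_ik) addr0 (ext_gf_geom s_gt0) ?mulrA // => le_si.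
by apply: IH; lia.
Qed.

(** Obtained by summing [end_gf_geom] over all last letters; only the maximal
    letter k.+1 also receives words with one letter fewer. *)
Lemma rgf_gf_rec (s k : nat) : (2 <= s)%N ->
  rgf_gf s k.+1 * (1 - x * \sum_(i < k.+1) geomz (i %/ s)) =
  x * rgf_gf s k * geomz (k %/ s).
Proof.
move=> s_ge2; have s_gt0 := ltnW s_ge2.
have last_k : end_gf s k.+1 k.+1 =
    x * rgf_gf s k.+1 * geomz (k %/ s) + x * rgf_gf s k * geomz (k %/ s).
  rewrite end_gf_rec ?ltnSn // eqxx mulrDr.
  rewrite !(ext_gf_geom s_gt0) ?mulrA // => le_sk.
    (* 2 <= s puts the letter (k - s).+1 strictly below the maximum k. *)
    by case: k le_sk => [|k] le_sk; [lia|apply: end_gf_geom; lia].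
  by apply: end_gf_geom; lia.
have rgfE : rgf_gf s k.+1 =
    x * rgf_gf s k.+1 * \sum_(i < k.+1) geomz (i %/ s) + x * rgf_gf s k * geomz (k %/ s).
  rewrite [LHS]rgf_gf_end !big_ord_recr /= last_k mulrDr addrA; congr (_ + _ + _).
  by rewrite mulr_sumr; apply: eq_bigr => i _; apply: end_gf_geom.
by rewrite mulrBr mulr1 {1}rgfE; ring.
Qed.

Lemma rgf_gf0 (s : nat) : rgf_gf s 0 = 1.
Proof. by apply: fpsP => -[|n] /=; rewrite ?big_nil // big_seq1. Qed.

Definition rgf_den (s k : nat) : fps {poly int} :=
  1 - x * \sum_(i < k) geomz (i %/ s).

Lemma rgf_gf_prod (s k : nat) : (2 <= s)%N ->
  rgf_gf s k * \prod_(j < k) rgf_den s j.+1 = x ^+ k * \prod_(i < k) geomz (i %/ s).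
Proof.
move=> s_ge2; elim: k => [|k IH]; first by rewrite !big_ord0 rgf_gf0 expr0.
rewrite !big_ord_recr /= mulrCA rgf_gf_rec // exprS.
transitivity (x * (rgf_gf s k * \prod_(i < k) rgf_den s i.+1) * geomz (k %/ s)); first by ring.
by rewrite IH; ring.
Qed.

(** * The closed form *)

(** Groups the indices i by the value of i %/ s: m full groups, then a partial
    one of size r. *)
Lemma big_divn (R : Type) (idx : R) (op : Monoid.law idx) (s m r : nat)
    (f : nat -> R) : (r <= s)%N -> (0 < s)%N ->
  \big[op/idx]_(0 <= i < m * s + r) f (i %/ s)%N =
  op (\big[op/idx]_(0 <= l < m) \big[op/idx]_(t < s) f l) (\big[op/idx]_(t < r) f m).
Proof.
move=> le_rs s_gt0; rewrite (big_cat_nat (n := m * s)) ?leq_addr //=.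
have block (l t : nat) : (t <= s)%N ->
    \big[op/idx]_(l * s <= i < l * s + t) f (i %/ s)%N = \big[op/idx]_(u < t) f l.
  move=> le_ts; rewrite -{1}[(l * s)%N]add0n big_addn addKn big_mkord.
  apply: eq_bigr => i _; rewrite addnC divnMDl // divn_small ?addn0 //.
  exact: leq_trans le_ts.
rewrite block // big_nat_mul; congr (op _ _).
by apply: eq_bigr => l _; rewrite mulSnr block.
Qed.

Definition D_den (s j : nat) : fps {poly int} :=
  1 - (j%:R - 2 + 2 * q) * x
    - (j%:R + s%:R - 1 + q) * (1 - q) * x ^+ 2
    + ((res1 s j)%:R * (1 + (1 - q) * x) - s%:R) * x
      * ((q - 1) * x) ^+ (quo1 s j).+1.

Lemma D_inv_den (s j : nat) : D s j = 1 / D_den s j. Proof. by []. Qed.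

(** The two factors 1 - z clear the geometric sums twice: once inside each
    S_m, once in the sum of z^(i/s + 1) over i < j, which collects s copies of
    each of z, ..., z^(j'') and j' copies of z^(j'' + 1). *)
Lemma rgf_den_D_den (s j : nat) : (0 < s)%N -> (0 < j)%N ->
  (1 - z) ^+ 2 * rgf_den s j = D_den s j.
Proof.
move=> s_gt0 j_gt0; rewrite /D_den /rgf_den.
have := res1_quo1P (s := s) j (j' := res1 s j) (quo1 s j).
rewrite {1}/res1 ltn_mod s_gt0 => /(_ isT)[_ /(_ (And3 j_gt0 erefl erefl))].
have : (res1 s j <= s)%N by rewrite /res1 ltn_mod.
move: (res1 s j) (quo1 s j) => r m le_rs jE.
have geom : (1 - z) * \sum_(0 <= l < m) z ^+ l.+1 = z - z ^+ m.+1.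
  have := mul_subz_geomz m; rewrite /geomz big_ord_recl expr0 -(big_mkord xpredT (fun l => z ^+ l.+1)).
  by rewrite mulrDr => /(canRL (addKr _)) ->; ring.
have sumS : (1 - z) * \sum_(i < j) geomz (i %/ s) =
    j%:R - (s%:R * \sum_(0 <= l < m) z ^+ l.+1 + r%:R * z ^+ m.+1).
  rewrite [LHS]mulr_sumr; under eq_bigr => i _ do rewrite mul_subz_geomz.
  rewrite sumrB sumr_const card_ord; congr (_ - _).
  rewrite -(big_mkord xpredT (fun i => z ^+ (i %/ s).+1)) jE addnC.
  rewrite (big_divn _ _ (fun i => z ^+ i.+1)) // sumr_const card_ord !mulr_natl.
  by rewrite -sumrMnl; congr (_ + _); apply: eq_bigr => l _; rewrite sumr_const card_ord.
have -> : (1 - z) ^+ 2 * (1 - x * \sum_(i < j) geomz (i %/ s)) =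
  (1 - z) ^+ 2 - x * (1 - z) * ((1 - z) * \sum_(i < j) geomz (i %/ s)) by ring.
rewrite sumS (_ : _ * (_ - _) = x * ((1 - z) * j%:R
   - s%:R * ((1 - z) * \sum_(0 <= l < m) z ^+ l.+1) - r%:R * (1 - z) * z ^+ m.+1)); last by ring.
rewrite geom -/z; move: (z ^+ m.+1) => w; rewrite /z; ring.
Qed.

Lemma unit_1subx (f : fps {poly int}) : 1 - x * f \is a GRing.unit.
Proof. by rewrite unitfpsE coef_fpsB coef_fpsXM subr0 unitr1. Qed.

Lemma unit_1subz : 1 - z \is a GRing.unit.
Proof. by rewrite /z mulrC unit_1subx. Qed.

(** The k - s denominators with j > s cost (1 - z)^(2(k - s)), of which half
    is spent on turning each S_(i/s) with s <= i into 1 - z^(i/s + 1). *)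
Lemma rgf_gf_D (s k : nat) : (2 <= s)%N -> (s <= k)%N ->
  rgf_gf s k = x ^+ k / \prod_(1 <= j < s.+1) (1 - j%:R * x)
    * ((1 - z) ^+ (k - s) * \prod_(s <= i < k) (1 - z ^+ (i %/ s).+1))
    * \prod_(s + 1 <= j < k.+1) D s j.
Proof.
move=> s_ge2 le_sk; have s_gt0 := ltnW s_ge2.
set U := \prod_(1 <= j < _) _; set PD := \prod_(_ <= j < _) D s j.
set V := \prod_(s + 1 <= j < k.+1) rgf_den s j.
set W := \prod_(s <= i < k) geomz (i %/ s).
have main : rgf_gf s k * (U * V) = x ^+ k * W.
  have := rgf_gf_prod k s_ge2.
  rewrite -(big_mkord xpredT (fun j => rgf_den s j.+1)).
  rewrite -(big_mkord xpredT (fun i => geomz (i %/ s))).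
  rewrite !(big_cat_nat (n := s) (leq0n s) le_sk) /=.
  have -> : \prod_(0 <= i < s) geomz (i %/ s) = 1.
    by rewrite big_mkord big1 // => i _; rewrite divn_small // geomz0.
  rewrite mul1r -(big_add1 _ _ 0 s.+1 xpredT (rgf_den s)).
  rewrite -(big_add1 _ _ s k.+1 xpredT (rgf_den s)).
  rewrite /V addn1; suff -> : U = \prod_(1 <= j < s.+1) rgf_den s j by [].
  apply: eq_big_nat => j /andP[_ le_js]; rewrite /rgf_den.
  under eq_bigr => i _ do rewrite divn_small ?(leq_trans (ltn_ord i)) // geomz0.
  by rewrite sumr_const card_ord mulrC.
have -> : (1 - z) ^+ (k - s) * \prod_(s <= i < k) (1 - z ^+ (i %/ s).+1) =
    ((1 - z) ^+ 2) ^+ (k - s) * W.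
  under eq_bigr => i _ do rewrite -mul_subz_geomz.
  by rewrite big_split prodr_const_nat /= -/W -exprM mul2n -addnn exprD mulrA.
have VD : ((1 - z) ^+ 2) ^+ (k - s) * V * PD = 1.
  have -> : (k - s)%N = (k.+1 - (s + 1))%N by lia.
  rewrite -prodr_const_nat -!big_split /= big_nat_cond big1 // => j.
  rewrite andbT => /andP[lt_sj _].
  rewrite D_inv_den -rgf_den_D_den ?mul1r //; last lia.
  by rewrite mulrV // unitrM unitrX ?unit_1subz // unit_1subx.
have U_unit : U \is a GRing.unit.
  rewrite /U big_nat_cond; apply: rpred_prod => j _.
  by rewrite mulrC unit_1subx.
transitivity (rgf_gf s k * (U * V) / U * ((1 - z) ^+ 2) ^+ (k - s) * PD).
  rewrite -[LHS]mulr1 -[X in _ * X = _]VD -[LHS](mulrK U_unit).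
  by set c := _ ^+ (k - s); set V' := U^-1; ring.
by rewrite main; set c := _ ^+ (k - s); set V' := U^-1; set xk := x ^+ k; ring.
Qed.

(** Telescoping; the statement avoids dividing by 1 - z^2, whose factor 1 + z
    is the one that appears in the theorem. *)
Lemma prod_shift (m : nat) : (0 < m)%N ->
  (1 - z ^+ 2) * \prod_(1 <= l < m) (1 - z ^+ (l + 2)) =
  \prod_(1 <= l < m) (1 - z ^+ (l + 1)) * (1 - z ^+ (m + 1)).
Proof.
elim: m => [//|[|m] IH] _; first by rewrite !big_geq // mulr1 mul1r.
have recr (F : nat -> fps {poly int}) :
  \prod_(1 <= l < m.+2) F l = \prod_(1 <= l < m.+1) F l * F m.+1.
  by rewrite big_nat_recr.
by rewrite !recr mulrA IH // !addn1 !addn2.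
Qed.

Theorem theorem4p1 (s k k' k'' : nat) (hs : (2 <= s)%N) (hk : (s + 1 <= k)%N)
    (hkdec : k = (k' + k'' * s)%N) (hk' : (1 <= k' <= s)%N)
    (hk'' : (1 <= k'')%N) :
  Pgf s k =
    (x ^+ k * (1 + (q - 1) * x) * (1 + (1 - q) * x) ^+ (k - s + 1)
       * (1 - ((q - 1) * x) ^+ (k'' + 1)) ^+ (k' - 1)
     / \prod_(1 <= j < s.+1) (1 - j%:R * x))
    * \prod_(1 <= l < k'')
        ((1 - ((q - 1) * x) ^+ (l + 1)) ^+ (s - 1)
         * (1 - ((q - 1) * x) ^+ (l + 2)))
    * \prod_(s + 1 <= j < k.+1) D s j.
Proof.
have [/andP[k'_gt0 le_k's] s_gt0] := (hk', ltnW hs).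
rewrite Pgf_rgf (rgf_gf_D hs); last by lia.
congr (_ * _).
rewrite -/z (_ : 1 + (1 - q) * x = 1 - z); last by rewrite /z; ring.
rewrite big_split /= prodrXl.
have -> : \prod_(s <= i < k) (1 - z ^+ (i %/ s).+1) =
    (\prod_(1 <= l < k'') (1 - z ^+ (l + 1))) ^+ s * (1 - z ^+ (k'' + 1)) ^+ k'.
  rewrite -{1}[s]add0n big_addn (_ : (k - s)%N = (k''.-1 * s + k')%N); last first.
    by rewrite hkdec -{1}(prednK hk'') mulSn; lia.
  under eq_bigr => i _ do rewrite divnDr ?dvdnn // divnn s_gt0 addn1.
  rewrite (big_divn _ _ (fun i => 1 - z ^+ i.+2)) // prodr_const card_ord.
  rewrite (prednK hk'') -prodrXl [in RHS]big_add1; rewrite addn1.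
  by congr (_ * _); apply: eq_bigr => l _; rewrite prodr_const card_ord addn1.
have := prod_shift hk''.
set A := \prod_(1 <= l < k'') (1 - z ^+ (l + 1)).
set A' := \prod_(1 <= l < k'') (1 - z ^+ (l + 2)) => shift.
set w := 1 - z ^+ (k'' + 1) in shift *.
have expS (f : fps {poly int}) n : (0 < n)%N -> f ^+ n = f * f ^+ (n - 1).
  by move=> n_gt0; rewrite -exprS -addn1 subnK.
rewrite (expS A s) // (expS w k') // addn1 exprS.
set V := _^-1; set a := A ^+ _; set b := w ^+ _; set c := _ ^+ (k - s).
transitivity (x ^+ k * V * c * a * b * (A * w)); first by ring.
by rewrite -shift; ring.
Qed.
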